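(* Let $q$ be a prime power, let $V=\mathbb{F}_q^{10}$ carry a nondegenerate quadratic form of plus type (hyperbolic), and let $\mathcal{M}$ be one of the two families of maximal totally singular subspaces (of dimension $5$) of $V$. Let $\Gamma$ be the graph with vertex set $\mathcal{M}$, two members being adjacent if their intersection has dimension $3$. Then $\Gamma$ is separating.
   Context: This graph is a connected component of the distance-$2$ graph of the dual polar graph of the polar space of rank $5$ and order $(q,1)$; it has $(q^4+1)(q^3+1)(q^2+1)(q+1)$ vertices. A graph $\Gamma$ is separating if $\omega(\Gamma)\alpha(\Gamma)<|V(\Gamma)|$, where $\omega$ and $\alpha$ are the maximum clique and coclique sizes. *)

(* Defs.v *)
From HB Require Import structures.
From mathcomp Require Import all_boot all_order all_algebra.

Set Implicit Arguments.
Unset Strict Implicit.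
Unset Printing Implicit Defensive.

Import GRing.Theory.
Local Open Scope ring_scope.

Section FiniteSubspaces.

(* Needed only to expose the subtype structure of {vspace vT}. *)
Import VectorInternalTheory.
Variables (F : finFieldType) (vT : vectType F).

HB.instance Definition _ := [Countable of {vspace vT} by <:].
HB.instance Definition _ := [Finite of {vspace vT} by <:].

End FiniteSubspaces.

Section SimpleGraphs.

(* A finite simple graph is given by an adjacency relation [e] on a finType.
   Only pairs of distinct vertices are ever tested for adjacency, so the values
   of [e] on the diagonal are irrelevant. *)
Variables (T : finType) (e : rel T).

Definition clique (A : {set T}) : bool :=
  [forall x in A, forall y in A, (x != y) ==> e x y].

Definition coclique (A : {set T}) : bool :=
  [forall x in A, forall y in A, (x != y) ==> ~~ e x y].

Definition clique_number : nat := (\max_(A : {set T} | clique A) #|A|)%N.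

Definition coclique_number : nat := (\max_(A : {set T} | coclique A) #|A|)%N.

Definition separating : Prop := (clique_number * coclique_number < #|T|)%N.

End SimpleGraphs.

Section QuadraticForms.

Variables (F : finFieldType) (n : nat).
Implicit Types (Q : 'rV[F]_n -> F) (U W : {vspace 'rV[F]_n}).

Definition polar_form Q (u v : 'rV[F]_n) : F := Q (u + v) - Q u - Q v.

(* The polar form is symmetric by construction, so linearity in the second
   argument is bilinearity. *)
Definition quadratic_form Q : Prop :=
  (forall (a : F) (v : 'rV[F]_n), Q (a *: v) = a ^+ 2 * Q v) /\
  (forall u : 'rV[F]_n, scalar (polar_form Q u)).

(* The radical of the polar form contains no nonzero singular vector; this is
   the definition that is valid in every characteristic. *)
Definition nondegenerate_qform Q : Prop :=
  forall v : 'rV[F]_n,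
    Q v = 0 -> (forall u : 'rV[F]_n, polar_form Q u v = 0) -> v = 0.

Definition totally_singular Q U : bool :=
  [forall v : 'rV[F]_n, (v \in U) ==> (Q v == 0)].

Definition witt_index Q : nat :=
  (\max_(U : {vspace 'rV[F]_n} | totally_singular Q U) \dim U)%N.

(* Plus type: the Witt index is half of the dimension of the space. *)
Definition hyperbolic Q : Prop := (witt_index Q).*2 = n.

Definition maximal_totally_singular Q U : bool :=
  totally_singular Q U &&
  [forall W : {vspace 'rV[F]_n},
     (totally_singular Q W && (U <= W)%VS) ==> (W == U)].

Definition maximals Q : {set {vspace 'rV[F]_n}} :=
  [set U | maximal_totally_singular Q U].

(* Two maximal totally singular subspaces belong to the same family when their
   intersection has even codimension in each of them. *)
Definition same_family U W : bool := ~~ odd (\dim U - \dim (U :&: W))%N.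

Definition families Q : {set {set {vspace 'rV[F]_n}}} :=
  equivalence_partition same_family (maximals Q).

End QuadraticForms.

(* For a family [M] of a hyperbolic form on F^10 this is a component of the
   distance-2 graph of the dual polar graph: codimension 2 is dimension 3. *)
Definition half_dual_polar_graph (F : finFieldType)
    (M : {set {vspace 'rV[F]_10}}) : rel {U : {vspace 'rV[F]_10} | U \in M} :=
  fun U W => \dim (val U :&: val W) == 3%N.
Arguments half_dual_polar_graph {F} M.

(* Main.v *)
(* If no two of [m] generators of one family meet in dimension 3, they meet
   pairwise in a single point. The first two moments of the number of them
   through a singular point are therefore determined, and Cauchy-Schwarz gives
   [m (q^2 + q + 1) <= (q^4 + 1) (q + 1) (q^2 + 1)]. If all of [c] generators
   of one family meet pairwise in dimension 3, either they all contain a fixed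
   2-dimensional subspace, or they all meet a fixed generator of the other family
   in dimension 4; in both cases [c <= (q^5 - 1) / (q - 1)]. As
   [|M| = (q + 1) (q^2 + 1) (q^3 + 1) (q^4 + 1)], the product of the two bounds is
   [|M| (q^5 - 1) / (q^6 - 1)]. *)
From HB Require Import structures.
Require Import Defs.
From mathcomp Require Import all_boot all_order all_algebra finfield zify ring.

Set Implicit Arguments.
Unset Strict Implicit.
Unset Printing Implicit Defensive.

Import GRing.Theory.
Local Open Scope ring_scope.

(* The generalizations keep [lia] from comparing subspaces up to conversion. *)
Ltac dim_lia :=
  repeat match goal with
    |- context [@dimv ?K ?vT ?U] => generalize (@dimv K vT U)
  end;
  repeat match goal with
    |- context [witt_index ?Q] => generalize (witt_index Q)
  end;
  clear; lia.

(** Summing [2 x_i x_j <= x_i ^ 2 + x_j ^ 2] over all ordered pairs gives Cauchy-Schwarz against the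
    constant 1. *)
Lemma sqr_sum_leq (I : finType) (A : {set I}) (x : I -> nat) :
  ((\sum_(i in A) x i) ^ 2 <= #|A| * \sum_(i in A) x i ^ 2)%N.
Proof.
rewrite -(leq_pmul2l (isT : 0 < 2)%N) -mulnn big_distrlr /= big_distrr /=.
have -> : (2 * (#|A| * \sum_(i in A) x i ^ 2) =
    \sum_(i in A) \sum_(j in A) (x i ^ 2 + x j ^ 2))%N.
  under [RHS]eq_bigr do rewrite big_split sum_nat_const /=.
  by rewrite big_split /= sum_nat_const -big_distrr /= addnn -mul2n.
apply: leq_sum => i _; rewrite big_distrr /=; apply: leq_sum => j _.
exact: nat_Cauchy.
Qed.

(** * Polar forms, totally singular subspaces and orthogonality *)

Section QuadraticSpaces.

Variables (F : finFieldType) (n : nat) (Q : 'rV[F]_n -> F).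
Hypothesis Q_quad : quadratic_form Q.
(* [{vspace 'rV[F]_n}] elaborates with a [reverse_coercion] wrapper that [lia]
   does not see through. *)
Local Notation subspace := ltac:(
  let T := eval cbv beta delta [reverse_coercion] in {vspace 'rV[F]_n} in exact T)
  (only parsing).
Implicit Types (u v w x : 'rV[F]_n) (a : F) (U W E H X Y Z : subspace).

Local Notation B := (polar_form Q).
Local Notation ts := (totally_singular Q).

Lemma polar_formC u v : B u v = B v u.
Proof. by rewrite /polar_form [v + u]addrC addrAC. Qed.

Lemma polar_formP u a v w : B u (a *: v + w) = a * B u v + B u w.
Proof. by have [_ /(_ u a v w)] := Q_quad. Qed.

Lemma polar_formDr u v w : B u (v + w) = B u v + B u w.
Proof. by rewrite -[v]scale1r polar_formP mul1r scale1r. Qed.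

Lemma polar_form0r u : B u 0 = 0.
Proof. by apply: (addrI (B u 0)); rewrite -polar_formDr !addr0. Qed.

Lemma polar_formZr u a v : B u (a *: v) = a * B u v.
Proof. by rewrite -[_ *: _]addr0 polar_formP polar_form0r addr0. Qed.

Lemma polar_formZl a u v : B (a *: u) v = a * B u v.
Proof. by rewrite polar_formC polar_formZr polar_formC. Qed.

Lemma polar_formDl u v w : B (u + v) w = B u w + B v w.
Proof. by rewrite polar_formC polar_formDr !(polar_formC w). Qed.

Lemma qformZ a v : Q (a *: v) = a ^+ 2 * Q v.
Proof. by case: Q_quad. Qed.

Lemma qformD u v : Q (u + v) = Q u + Q v + B u v.
Proof. by rewrite /polar_form; ring. Qed.

Lemma qform0 : Q 0 = 0.
Proof. by rewrite -[0](scale0r (0 : 'rV[F]_n)) qformZ expr0n mul0r. Qed.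

Lemma totally_singularP U : reflect {in U, forall v, Q v = 0} (ts U).
Proof.
apply: (iffP forallP) => [h v /(implyP (h v)) /eqP // | h v].
by apply/implyP => /h ->.
Qed.

Lemma totally_singularS U W : (U <= W)%VS -> ts W -> ts U.
Proof.
by move=> /subvP sUW /totally_singularP h; apply/totally_singularP => v /sUW /h.
Qed.

Lemma totally_singular0 : ts 0%VS.
Proof. by apply/totally_singularP => v; rewrite memv0 => /eqP->; apply: qform0. Qed.

(** Written as the kernel of the pairing with a basis of [E], a map into a space of dimension
    [\dim E], so that rank-nullity bounds the codimension. *)
Definition perp E : subspace :=
  lker (linfun (fun v => \row_(i < \dim E) B (vbasis E)`_i v)).

Lemma memv_perp E v : reflect {in E, forall u, B u v = 0} (v \in perp E).
Proof.
pose f v := \row_(i < \dim E) B (vbasis E)`_i v.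
(* [perp] applies [linfun] to a bare function; evaluating it by [lfunE] requires the linear
   structure built here. *)
have f_lin : linear f by move=> a u w; apply/rowP=> i; rewrite !mxE polar_formP.
pose f' : {linear _ -> _} := HB.pack f (GRing.isLinear.Build _ _ _ _ f f_lin).
rewrite memv_ker (_ : linfun _ v = f v); last exact: (lfunE f' v).
apply: (iffP eqP) => [fv0 u /coord_vbasis -> | h].
  elim/big_rec: _ => [|i w _ IH]; first by rewrite polar_formC polar_form0r.
  rewrite polar_formDl polar_formZl IH.
  by move/rowP/(_ i): fv0; rewrite !mxE => ->; rewrite mulr0 addr0.
by apply/rowP=> i; rewrite !mxE h // vbasis_mem // mem_nth // size_tuple.
Qed.

Lemma perp_codim E X : (\dim X <= \dim (X :&: perp E) + \dim E)%N.
Proof.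
rewrite -(limg_ker_dim (linfun (fun v => \row_(i < \dim E) B (vbasis E)`_i v)) X).
rewrite leq_add2l; apply: leq_trans (dimvS (subvf _)) _.
by rewrite dimvf /dim /= mul1n.
Qed.

Lemma sub_perpC U W : (U <= perp W)%VS = (W <= perp U)%VS.
Proof.
suff h X Y : (X <= perp Y)%VS -> (Y <= perp X)%VS by apply/idP/idP; apply: h.
move=> /subvP sXY; apply/subvP => w Yw; apply/memv_perp => u Xu.
by rewrite polar_formC; move/memv_perp: (sXY u Xu); apply.
Qed.

Lemma perpS U W : (U <= W)%VS -> (perp W <= perp U)%VS.
Proof. by move=> sUW; rewrite sub_perpC (subv_trans sUW) // sub_perpC. Qed.

(** Vectors of [E] orthogonal to [X] impose no condition on [X], so in [perp_codim] the space [E]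
    may be replaced by a complement in it of [E :&: perp X]. *)
Lemma perp_codim_sub E X :
  (\dim X + \dim (E :&: perp X) <= \dim (X :&: perp E) + \dim E)%N.
Proof.
have := perp_codim (E :\: perp X) X.
have := dimv_cap_compl E (perp X).
suff -> : (X :&: perp (E :\: perp X) = X :&: perp E)%VS by lia.
apply/eqP; rewrite eqEsubv; apply/andP; split; last first.
  by rewrite capvS // perpS // diffvSl.
rewrite subv_cap capvSl sub_perpC -{1}(addv_diff_cap E (perp X)) subv_add.
by rewrite sub_perpC capvSr /= (subv_trans (capvSr _ _)) // perpS // capvSl.
Qed.

(* The bilinear pairing between [X] and [E] has equal left and right ranks. *)
Lemma dim_cap_perp E X :
  (\dim (X :&: perp E) + \dim E = \dim X + \dim (E :&: perp X))%N.
Proof. by have := perp_codim_sub E X; have := perp_codim_sub X E; lia. Qed.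

Lemma totally_singular_perp U : ts U -> (U <= perp U)%VS.
Proof.
move=> /totally_singularP tU; apply/subvP => v Uv; apply/memv_perp => u Uu.
by rewrite /polar_form !tU ?memvD // !subr0.
Qed.

Lemma totally_singularD U W : ts U -> ts W -> (W <= perp U)%VS -> ts (U + W)%VS.
Proof.
move=> /totally_singularP tU /totally_singularP tW /subvP sWU.
apply/totally_singularP => _ /memv_addP[u Uu [w Ww ->]].
by rewrite qformD tU // tW //; move/memv_perp: (sWU w Ww) => ->; rewrite ?addr0.
Qed.

Lemma totally_singular_line v : ts <[v]>%VS = (Q v == 0).
Proof.
apply/totally_singularP/eqP => [-> // | Qv _ /vlineP[a ->]]; first exact: memv_line.
by rewrite qformZ Qv mulr0.
Qed.

Lemma perpD U W : (perp (U + W) = perp U :&: perp W)%VS.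
Proof.
apply/eqP; rewrite eqEsubv subv_cap !perpS ?addvSl ?addvSr //=.
by rewrite sub_perpC subv_add sub_perpC capvSl sub_perpC capvSr.
Qed.


(** * Generators of a nondegenerate hyperbolic space *)

Hypothesis Q_nondeg : nondegenerate_qform Q.
Hypothesis Q_hyperbolic : hyperbolic Q.

Local Notation d := (witt_index Q).

(** Maximality expressed by dimension; [maximal_totally_singularE] identifies it with maximality
    under inclusion. *)
Definition generator W := ts W && (\dim W == d).

Lemma generator_ts W : generator W -> ts W.
Proof. by case/andP. Qed.

Lemma generator_dim W : generator W -> \dim W = d.
Proof. by case/andP=> _ /eqP. Qed.

Lemma dim_totally_singular U : ts U -> (\dim U <= d)%N.
Proof. by move=> tU; apply: (leq_bigmax_cond (F := fun U => \dim U)). Qed.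

Lemma generator_eq U W : generator U -> generator W -> (U <= W)%VS -> U = W.
Proof.
move=> gU gW sUW; apply/eqP.
by rewrite eqEdim sUW (generator_dim gU) (generator_dim gW) /=.
Qed.

Lemma ex_generator : exists W, generator W.
Proof.
have card_gt0 : (0 < #|[pred U | ts U]|)%N.
  by apply/card_gt0P; exists 0%VS; apply: totally_singular0.
have [W tW dW] := eq_bigmax_cond (fun U : subspace => \dim U) card_gt0.
by exists W; rewrite /generator [ts W]tW; apply/eqP.
Qed.

(** Nondegeneracy keeps nonzero singular vectors out of the radical [perp fullv], so a totally
    singular [U] meets it trivially and [dim_cap_perp] applies. *)
Lemma dim_perp U : ts U -> (\dim (perp U) + \dim U = n)%N.
Proof.
move=> /totally_singularP tU; have := dim_cap_perp U fullv.
rewrite capfv dimvf /dim /= mul1n.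
suff -> : (U :&: perp fullv = 0)%VS by rewrite dimv0 addn0.
apply/eqP; rewrite -subv0; apply/subvP => v; rewrite memv_cap memv0.
case/andP=> Uv /memv_perp v_rad; apply/eqP/Q_nondeg => [|u]; first exact: tU.
by apply: v_rad; rewrite memvf.
Qed.

(** Plus type gives [n = 2d], so [W] and the space [perp W] containing it have equal dimension. *)
Lemma perp_generator W : generator W -> perp W = W.
Proof.
move=> gW; have tW := generator_ts gW; apply/esym/eqP.
rewrite eqEdim totally_singular_perp //=; move: (dim_perp tW) Q_hyperbolic.
by rewrite (generator_dim gW) /hyperbolic -addnn => h1 h2; rewrite -(leq_add2r d) h1 h2.
Qed.

Lemma dim_generator_cap_perp W E :
  generator W -> (\dim (W :&: perp E) + \dim E = d + \dim (E :&: W))%N.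
Proof. by move=> gW; rewrite dim_cap_perp perp_generator // generator_dim. Qed.

Lemma dim_add_line U v : v \notin U -> \dim (U + <[v]>)%VS = (\dim U).+1.
Proof.
move=> Uv; rewrite dimv_disjoint_sum ?dim_vline.
  by case: eqP Uv => [->|_ _]; rewrite ?mem0v ?addn1.
apply/eqP; rewrite -subv0; apply/subvP => w /memv_capP[Uw /vlineP[a w_av]].
move: Uw; rewrite w_av memv0; have [->|a0] := eqVneq a 0; first by rewrite scale0r.
by rewrite rpredZeq (negPf a0) (negPf Uv).
Qed.

Lemma totally_singular_add_line U v :
  ts U -> Q v = 0 -> v \in perp U -> ts (U + <[v]>)%VS.
Proof.
by move=> tU Qv Uv; rewrite totally_singularD // ?totally_singular_line ?Qv // -memvE.
Qed.

(** If [\dim W < d], then for any generator [G] the space [G :&: perp W] has dimension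
    [d + \dim (W :&: G) - \dim W], more than [\dim (W :&: G)]. It thus contains a singular vector
    outside [W] that extends [W]. *)
Lemma maximal_totally_singularE W : maximal_totally_singular Q W = generator W.
Proof.
apply/andP/idP => [[tW /forallP maxW] | gW]; last first.
  split; first exact: generator_ts.
  apply/forallP => U; apply/implyP => /andP[tU sWU].
  by rewrite eq_sym eqEdim sWU (generator_dim gW) dim_totally_singular.
rewrite /generator tW eqn_leq dim_totally_singular //= leqNgt; apply/negP => ltW.
have [G gG] := ex_generator.
have : ~~ (G :&: perp W <= W :&: G)%VS.
  by apply/negP => /dimvS; have := dim_generator_cap_perp W gG; lia.
case/subvPn => v /memv_capP[Gv Wv]; rewrite memv_cap Gv andbT => nWv.
have tGv : Q v = 0 by move/totally_singularP: (generator_ts gG); apply.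
have /implyP := maxW (W + <[v]>)%VS.
rewrite totally_singular_add_line // addvSl => /(_ isT) /eqP eqW.
by have := dim_add_line nWv; rewrite eqW; lia.
Qed.

Lemma sub_generator U : ts U -> exists2 W, generator W & (U <= W)%VS.
Proof.
move=> tU; have pU : ts U && (U <= U)%VS by rewrite tU subvv.
pose P W := ts W && (U <= W)%VS.
case: (@arg_maxnP _ U P (fun W => \dim W) pU) => W /andP[tW sUW] maxW.
exists W => //; rewrite -maximal_totally_singularE /maximal_totally_singular tW /=.
apply/forallP => X; apply/implyP => /andP[tX sWX].
by rewrite eq_sym eqEdim sWX; apply: maxW; rewrite /P tX (subv_trans sUW).
Qed.

(** * Adjacency in the dual polar graph and parity of intersections *)

Definition adjacent W W' := (\dim (W :&: W')).+1 = d.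

Lemma dim_generator_cap_line W v :
  generator W -> v \notin W -> (\dim (W :&: perp <[v]>)).+1 = d.
Proof.
move=> gW Wv; have := dim_generator_cap_perp <[v]> gW.
have v0 : v != 0 by apply: contraNneq Wv => ->; rewrite mem0v.
suff -> : (<[v]> :&: W = 0)%VS by rewrite dimv0 dim_vline v0 /=; lia.
apply/eqP; rewrite -dimv_eq0; have := dimv_sum_cap <[v]> W.
rewrite addvC dim_add_line // dim_vline v0 /= => dim_eq.
by have -> : \dim (<[v]> :&: W) = 0%N by lia.
Qed.

(** For singular [v] outside the generator [W], this is the unique generator through [v] adjacent to
    [W]. *)
Definition neighbour v W := ((W :&: perp <[v]>) + <[v]>)%VS.

Lemma neighbour_generator W v :
  generator W -> Q v = 0 -> v \notin W -> generator (neighbour v W).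
Proof.
move=> gW Qv Wv; apply/andP; split.
  apply: totally_singular_add_line => //.
    exact: totally_singularS (capvSl _ _) (generator_ts gW).
  by rewrite memvE sub_perpC // capvSr.
by rewrite dim_add_line ?dim_generator_cap_line // memv_cap (negPf Wv).
Qed.

Lemma mem_neighbour v W : v \in neighbour v W.
Proof. by rewrite memvE addvSr. Qed.

Lemma generator_cap_neq U W :
  generator U -> generator W -> U != W -> (\dim (U :&: W) < d)%N.
Proof.
move=> gU gW; apply: contraNT; rewrite -leqNgt => le_d; apply/eqP.
apply: generator_eq => //; apply/capv_idPl/eqP.
by rewrite eqEdim capvSl (generator_dim gU).
Qed.

Lemma neighbour_adjacent W v :
  generator W -> Q v = 0 -> v \notin W -> adjacent W (neighbour v W).
Proof.
move=> gW Qv Wv; have gN := neighbour_generator gW Qv Wv.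
have W_N : W != neighbour v W.
  by apply: contraNneq Wv => ->; apply: mem_neighbour.
have := generator_cap_neq gW gN W_N.
have /dimvS : (W :&: perp <[v]> <= W :&: neighbour v W)%VS.
  by rewrite subv_cap capvSl addvSl.
by have := dim_generator_cap_line gW Wv; rewrite /adjacent; lia.
Qed.

Lemma generatorP W v : generator W -> v \in W -> Q v = 0.
Proof. by move=> /generator_ts/totally_singularP; apply. Qed.

Lemma sub_perp_generator U W : generator W -> (U <= W)%VS -> (W <= perp U)%VS.
Proof. by move=> gW sUW; rewrite sub_perpC // perp_generator. Qed.

Lemma perp_adjacent W W' : generator W -> generator W' -> adjacent W W' ->
  perp (W :&: W') = (W + W')%VS.
Proof.
move=> gW gW' adj; apply/esym/eqP; rewrite eqEdim subv_add.
rewrite !sub_perp_generator ?capvSl ?capvSr //=.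
have := dim_perp (totally_singularS (capvSl W W') (generator_ts gW)).
have := dimv_sum_cap W W'; move: Q_hyperbolic adj.
by rewrite /hyperbolic /adjacent (generator_dim gW) (generator_dim gW'); lia.
Qed.

(** Modulo [H = W :&: W'], the space [perp H = W + W'] is a hyperbolic plane, with only two singular
    lines. If [z = w + w'] is singular then [B w w' = 0]; when [w] is outside [W'], this puts [w']
    in [perp W = W]. *)
Lemma generator_on_adjacent W W' Z :
  generator W -> generator W' -> generator Z -> adjacent W W' ->
  (W :&: W' <= Z)%VS -> Z = W \/ Z = W'.
Proof.
move=> gW gW' gZ adj sHZ; have pH := perp_adjacent gW gW' adj.
have gen_line G v : generator G -> (W :&: W' <= G)%VS -> v \in G ->
    v \notin (W :&: W')%VS -> (W :&: W' + <[v]> = G)%VS.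
  move=> gG sHG Gv Hv; apply/eqP; rewrite eqEdim subv_add sHG -memvE Gv /=.
  by rewrite dim_add_line // (generator_dim gG) adj.
have [|/subvPn[z Zz nWz]] := boolP (Z <= W)%VS.
  by left; apply: generator_eq.
have nHz : z \notin (W :&: W')%VS by apply: contraNN nWz => /memv_capP[].
right.
have : z \in perp (W :&: W') by apply: (subvP (sub_perp_generator gZ sHZ)).
rewrite pH => /memv_addP[w Ww [w' W'w' def_z]].
have nWw' : w' \notin W by apply: contraNN nWz => Ww'; rewrite def_z memvD.
have [W'w|nW'w] := boolP (w \in W').
  have W'z : z \in W' by rewrite def_z memvD.
  by rewrite -(gen_line Z z) // (gen_line W' z) // capvSr.
case/negP: nWw'; rewrite -(perp_generator gW) -(gen_line W w) ?capvSl //; last first.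
  by rewrite memv_cap (negPf nW'w) andbF.
rewrite perpD // memv_cap pH (subvP (addvSr W W')) //=.
apply/memv_perp => // _ /vlineP[a ->]; rewrite polar_formZl //.
have := generatorP gZ Zz.
rewrite def_z qformD (generatorP gW) // (generatorP gW') // !add0r => ->.
by rewrite mulr0.
Qed.

(** The projection [K] of [U] onto [H = W :&: W'] is a generator over [H], hence [W] or [W']. The
    one equal to [K] meets [U] in [U :&: perp H], the other in [U :&: H], which has one dimension
    less. *)
Lemma dim_cap_adjacent U W W' :
  generator U -> generator W -> generator W' -> adjacent W W' ->
  \dim (U :&: W) = (\dim (U :&: W')).+1 \/ \dim (U :&: W') = (\dim (U :&: W)).+1.
Proof.
move=> gU gW gW' adj.
pose H := (W :&: W')%VS; pose K := (H + (U :&: perp H))%VS.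
have tH : ts H := totally_singularS (capvSl _ _) (generator_ts gW).
have dUH := dim_generator_cap_perp H gU.
have gK : generator K.
  apply/andP; split.
    by rewrite totally_singularD ?capvSr // (totally_singularS (capvSl _ _)) ?generator_ts.
  have cap_H : (H :&: (U :&: perp H) = H :&: U)%VS.
    by rewrite (capvC U) capvA (capv_idPl (totally_singular_perp _)).
  have := dimv_sum_cap H (U :&: perp H); rewrite cap_H -/K => dK.
  by apply/eqP; move: adj; rewrite /adjacent -/H; lia.
have half X X' : generator X -> (X :&: X' = H)%VS -> (H <= X')%VS ->
    generator X' -> K = X -> \dim (U :&: X) = (\dim (U :&: X')).+1.
  move=> gX capX sHX' gX' KX; have sHX : (H <= X)%VS by rewrite -capX capvSl.
  have -> : (U :&: X = U :&: perp H)%VS.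
    apply/eqP; rewrite eqEsubv capvS ?sub_perp_generator //=.
    by rewrite subv_cap capvSl -KX addvSr.
  suff -> : (U :&: X' = H :&: U)%VS by move: adj; rewrite /adjacent -/H; lia.
  apply/eqP; rewrite eqEsubv andbC capvC capvS //=.
  rewrite subv_cap capvSl -capX subv_cap andbC capvSr /= -KX.
  by rewrite (subv_trans _ (addvSr _ _)) // capvS // sub_perp_generator.
have [KW|KW'] := generator_on_adjacent gW gW' gK adj (addvSl _ _).
  by left; apply: half; rewrite ?capvSr.
by right; apply: half; rewrite ?capvSl // capvC.
Qed.

(* Walking from [W] to [Z] through adjacent generators, each step brings [W]
   one dimension closer to [Z] and changes [\dim (U :&: W)] by one. *)
Lemma generator_parity U W Z :
  generator U -> generator W -> generator Z ->
  odd (\dim (U :&: W) + \dim (U :&: Z) + \dim (W :&: Z)) = odd d.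
Proof.
move=> gU + gZ; move def_k: (d - \dim (W :&: Z))%N => k.
elim: k W def_k => [|k IH] W def_k gW.
  have [<-|neWZ] := eqVneq W Z; last by have := generator_cap_neq gW gZ neWZ; lia.
  by rewrite addnn oddD odd_double capvv (generator_dim gW).
have [|/subvPn[z Zz Wz]] := boolP (Z <= W)%VS.
  move/(generator_eq gZ gW) => eqZ; move: def_k.
  by rewrite eqZ capvv (generator_dim gW); lia.
have Qz := generatorP gZ Zz; have gN := neighbour_generator gW Qz Wz.
have adj := neighbour_adjacent gW Qz Wz.
have : (\dim (W :&: Z) < \dim (neighbour z W :&: Z))%N.
  rewrite -(@dim_add_line _ z); last by rewrite memv_cap (negPf Wz).
  apply: dimvS; rewrite subv_cap !subv_add -!memvE capvSr Zz mem_neighbour !andbT.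
  rewrite (subv_trans _ (addvSl _ _)) // capvS // sub_perp_generator //.
have := dim_cap_adjacent gZ gW gN adj; have := dim_cap_adjacent gU gW gN adj.
have := IH (neighbour z W); rewrite !(capvC Z) => IHN dU dZ lt_dim.
have /IHN/(_ gN) : (d - \dim (neighbour z W :&: Z) = k)%N.
  by move: def_k dZ lt_dim; dim_lia.
by move: dU dZ lt_dim; dim_lia.
Qed.

(** * Counting singular vectors *)

Local Notation q := #|F|.

Lemma card_field_gt1 : (1 < q)%N.
Proof. exact: finNzRing_gt1. Qed.

Lemma card_expn_gt0 k : (0 < q ^ k)%N.
Proof. by rewrite expn_gt0 (ltnW card_field_gt1). Qed.

(** On [W] the map [w -> Q (x + w) = Q x + B x w] is affine, and nonconstant because [x] is not in
    [W = perp W]. Its zero set is a coset of the hyperplane [W :&: perp <[x]>]. *)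
Lemma card_singular_translate W x : generator W -> x \notin W ->
  (#|[set w in W | Q (x + w)%R == 0%R]| * q = q ^ d)%N.
Proof.
move=> gW Wx; have : ~~ (W <= perp <[x]>)%VS.
  by rewrite sub_perpC // perp_generator // -memvE.
case/subvPn => y Wy nxy; have Bxy : B x y != 0.
  apply: contraNneq nxy => Bxy; apply/memv_perp => // _ /vlineP[a ->].
  by rewrite polar_formZl // Bxy mulr0.
pose w0 := (- Q x / B x y) *: y; have Ww0 : w0 \in W by rewrite rpredZ.
have Bxw0 : B x w0 = - Q x by rewrite polar_formZr // divfK.
rewrite (_ : [set _ | _] = [set w0 + w | w in (W :&: perp <[x]>)%VS]); last first.
  apply/setP => w; rewrite inE; apply/andP/imsetP => [[Ww /eqP Qxw] | [w' ]].
    exists (w - w0); last by rewrite addrC subrK.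
    rewrite memv_cap rpredB //; apply/memv_perp => // _ /vlineP[a ->].
    move: Qxw; rewrite qformD (generatorP gW Ww) addr0 polar_formZl // => Qxw.
    by rewrite -scaleN1r polar_formDr // polar_formZr // Bxw0 mulN1r opprK addrC Qxw mulr0.
  case/memv_capP => Ww' /memv_perp Bxw' ->; have Ww : w0 + w' \in W by rewrite rpredD.
  split=> //; rewrite qformD (generatorP gW Ww) polar_formDr // Bxw0.
  by rewrite Bxw' ?memv_line // !addr0 subrr.
rewrite card_imset; last exact: addrI.
by rewrite card_vspace -expnSr dim_generator_cap_line.
Qed.

Definition singular_perp E : {set 'rV[F]_n} := [set v in perp E | Q v == 0].

(* Count the pairs [(x, w)] in [perp E * W] with [Q (x + w) = 0], for a
   generator [W] containing [E]. *)
Lemma card_singular_perp E : ts E ->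
  (#|singular_perp E| * q + q ^ d = q ^ d.+1 + q ^ (n - \dim E))%N.
Proof.
move=> tE; have [W gW sEW] := sub_generator tE.
have sWX := sub_perp_generator gW sEW.
have dX : \dim (perp E) = (n - \dim E)%N by have := dim_perp tE; lia.
(* The weight [q] turns the contribution [q ^ (d - 1)] of each [x] outside [W] into [q ^ d]. In
   [c1], translation by [w] permutes [perp E]; in [c2], the sum is split by whether [x] lies in
   [W]. *)
pose c := (\sum_(x in perp E) \sum_(w in W) (Q (x + w)%R == 0%R) * q)%N.
have c1 : c = (#|W| * (#|singular_perp E| * q))%N.
  rewrite /c exchange_big /= -sum_nat_const; apply: eq_bigr => w Ww.
  rewrite -big_distrl /=; congr (_ * _)%N.
  rewrite (reindex_inj (addIr (- w))) /= -sum1_card big_mkcond /=.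
  rewrite [RHS]big_mkcond; apply: eq_bigr => x _.
  rewrite subrK rpredBr; last exact: (subvP sWX).
  by rewrite inE; case: (x \in perp E); case: (Q x == 0).
have c2 : c = (#|W| * q ^ d.+1 + (#|perp E| - #|W|) * q ^ d)%N.
  have -> : (#|perp E| - #|W| = #|[predD perp E & W]|)%N.
    rewrite -(cardID (mem W) (mem (perp E))) (_ : #|[predI _ & _]| = #|W|) ?addKn //.
    by apply: eq_card => x; rewrite !inE andb_idl // => /(subvP sWX).
  rewrite /c (bigID (mem W)) /= -!sum_nat_const; congr (_ + _)%N.
    apply: congr_big => // x; first by rewrite andb_idl // => /(subvP sWX).
    case/andP => _ Wx; rewrite -big_distrl /= expnSr; congr (_ * _)%N.
    rewrite -(generator_dim gW) -card_vspace -sum1_card; apply: eq_bigr => w Ww.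
    by rewrite (generatorP gW) ?eqxx // rpredD.
  apply: congr_big => // x; first by rewrite !inE andbC.
  case/andP=> _ Wx; rewrite -(card_singular_translate gW Wx) -big_distrl /=.
  congr (_ * _)%N; rewrite -sum1_card big_mkcond [RHS]big_mkcond /=.
  by apply: eq_bigr => w _; rewrite inE; case: (w \in W); case: eqP.
have := dimvS sWX; rewrite dX => le_dim.
apply/eqP; rewrite -(eqn_pmul2l (card_expn_gt0 d)); apply/eqP.
have := leq_pexp2l (ltnW card_field_gt1) le_dim.
move: c1; rewrite c2 !card_vspace dX (generator_dim gW) !expnS.
by nia.
Qed.

(** * One family of generators: parity and size *)

Variable M : {set subspace}.
Hypothesis M_family : M \in families Q.

Lemma family_generator W : W \in M -> generator W.
Proof.
case/imsetP: M_family => U _ ->; rewrite !inE => /andP[].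
by rewrite maximal_totally_singularE.
Qed.

Lemma dim_capr_generator U W : generator W -> (\dim (U :&: W) <= d)%N.
Proof. by move=> gW; rewrite -(generator_dim gW) dimvS ?capvSr. Qed.

(** [M] is the class of some generator [U]. By [generator_parity], the codimensions of the three
    pairwise intersections of [U], [W] and [Z] have even sum. *)
Lemma family_parity W Z : generator W -> generator Z ->
  ((W \in M) == (Z \in M)) = ~~ odd (d - \dim (W :&: Z)).
Proof.
move=> gW gZ; case/imsetP: M_family => U; rewrite inE maximal_totally_singularE => gU ->.
rewrite !inE !maximal_totally_singularE gW gZ /same_family (generator_dim gU) /=.
have := generator_parity gU gW gZ; rewrite !oddB ?dim_capr_generator // !oddD => <-.
by case: (odd _); case: (odd _); case: (odd _).
Qed.

Lemma family_adjacent W Z : generator W -> generator Z -> adjacent W Z ->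
  (W \in M) = (Z \notin M).
Proof.
move=> gW gZ adj; have := family_parity gW gZ.
rewrite -adj subSn // subnn /=.
by case: (W \in M); case: (Z \in M).
Qed.

Lemma family_cap W Z : W \in M -> Z \in M -> ~~ odd (d - \dim (W :&: Z)).
Proof.
by move=> MW MZ; rewrite -family_parity ?family_generator // MW MZ.
Qed.

Definition family_over E := [set W in M | (E <= W)%VS].

(** If a generator over [H] lies outside [M], a suitable neighbour of it over [H] lies in [M]. Two
    distinct generators over [H] are adjacent, hence not both in [M]. *)
Lemma card_family_over_hyperplane H :
  ts H -> (\dim H).+1 = d -> #|family_over H| = 1%N.
Proof.
move=> tH dH.
have [W MW sHW] : exists2 W, W \in M & (H <= W)%VS.
  have [W gW sHW] := sub_generator tH; have [|nMW] := boolP (W \in M).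
    by exists W.
  have sWX := sub_perp_generator gW sHW.
  have /subvPn[x Xx Wx] : ~~ (perp H <= W)%VS.
    apply/negP => /dimvS; rewrite (generator_dim gW).
    by have := dim_perp tH; move: Q_hyperbolic; rewrite /hyperbolic; lia.
  (* The vector [x] itself may be nonsingular; adding a suitable [w] from [W] makes it singular and
     keeps it in [perp H] and outside [W]. *)
  have /card_gt0P[w] : (0 < #|[set w in W | Q (x + w)%R == 0%R]|)%N.
    by have := card_expn_gt0 d; rewrite -(card_singular_translate gW Wx) muln_gt0 => /andP[].
  rewrite inE => /andP[Ww /eqP Qxw].
  have Wxw : x + w \notin W by rewrite rpredDr.
  exists (neighbour (x + w) W).
    have := family_adjacent gW (neighbour_generator gW Qxw Wxw).
    by rewrite (negPf nMW) => /(_ (neighbour_adjacent gW Qxw Wxw))/esym/negbFE.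
  rewrite (subv_trans _ (addvSl _ _)) // subv_cap sHW sub_perpC // -memvE.
  by rewrite rpredD // (subvP sWX).
apply/eqP/cards1P; exists W; apply/setP => Z; rewrite !inE.
apply/andP/eqP => [[MZ sHZ] | -> //]; apply/eqP; apply: contraTT (MZ) => neZW.
have [gW gZ] := (family_generator MW, family_generator MZ).
rewrite -(family_adjacent gW gZ) // /adjacent.
have := generator_cap_neq gZ gW neZW; rewrite capvC.
have /dimvS : (H <= W :&: Z)%VS by rewrite subv_cap sHW.
by move: dH; dim_lia.
Qed.

Lemma card_diff_generator W E : generator W -> (E <= W)%VS ->
  (#|[set v in W | v \notin E]| + q ^ \dim E = q ^ d)%N.
Proof.
move=> gW sEW; rewrite -(generator_dim gW) -!card_vspace -(cardID (mem E) (mem W)) addnC.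
congr (_ + _)%N; apply: eq_card => v; rewrite !inE; last by rewrite andbC.
by rewrite andb_idl // => /(subvP sEW).
Qed.

Lemma card_diff_singular_perp E : ts E ->
  (#|[set v in singular_perp E | v \notin E]| + q ^ \dim E = #|singular_perp E|)%N.
Proof.
move=> tE; rewrite -card_vspace -(cardID (mem E) (mem (singular_perp E))) addnC.
congr (_ + _)%N; apply: eq_card => v; rewrite !inE; last by rewrite andbC.
have [Ev|] := boolP (v \in E); rewrite ?andbF //= andbT.
rewrite (subvP (totally_singular_perp tE)) //=.
by move/totally_singularP: tE => ->; rewrite ?eqxx.
Qed.

(* Count the pairs [(W, v)] with [W] a member of [M] over [E] and [v] in [W]
   outside [E]. *)
Lemma card_family_over k E : ts E -> (\dim E + k.+1 = d)%N ->
  #|family_over E| = (\prod_(i < k) (q ^ i.+1 + 1))%N.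
Proof.
elim: k E => [|k IH] E tE dE.
  by rewrite big_ord0 card_family_over_hyperplane // -addn1.
have double_count : (\sum_(W in family_over E) #|[set v in W | v \notin E]|
    = \sum_(v in [set v in singular_perp E | v \notin E]) #|family_over (E + <[v]>)|)%N.
  under eq_bigr do rewrite -sum1_card.
  rewrite (exchange_big_dep (mem [set v in singular_perp E | v \notin E])) /=.
    apply: eq_bigr => v; rewrite !inE => /andP[_ Ev]; rewrite -sum1_card.
    by apply: eq_bigl => W; rewrite !inE subv_add -memvE Ev andbT andbA.
  move=> W v; rewrite !inE => /andP[MW sEW] /andP[Wv ->]; rewrite andbT.
  have gW := family_generator MW.
  by rewrite (subvP (sub_perp_generator gW sEW)) //= (generatorP gW).
have D_eq W : W \in family_over E ->
    #|[set v in W | v \notin E]| = (q ^ d - q ^ \dim E)%N.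
  rewrite inE => /andP[MW sEW].
  by rewrite -(card_diff_generator (family_generator MW) sEW) addnK.
rewrite (eq_bigr _ D_eq) sum_nat_const in double_count.
have deg_eq v : v \in [set v in singular_perp E | v \notin E] ->
    #|family_over (E + <[v]>)| = (\prod_(i < k) (q ^ i.+1 + 1))%N.
  rewrite !inE => /andP[/andP[Xv /eqP Qv] Ev]; apply: IH.
    exact: totally_singular_add_line.
  by rewrite dim_add_line // addSnnS.
rewrite (eq_bigr _ deg_eq) sum_nat_const in double_count.
rewrite big_ord_recr /=; move: double_count; set P := (\prod_(i < k) _)%N.
have := card_singular_perp tE; have := card_diff_singular_perp tE.
set s' := #|[set v in _ | _]|; set s := #|singular_perp E|; set f := #|family_over E|.
have -> : (n - \dim E = d + k.+2)%N by move: Q_hyperbolic; rewrite /hyperbolic; lia.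
have q_d : (q ^ d = q ^ \dim E * (q ^ k.+1 * q))%N by rewrite -dE expnD expnSr.
have q_gt1 := card_field_gt1; have a_gt0 := card_expn_gt0 (\dim E).
have b_gt0 := card_expn_gt0 k.+1.
rewrite expnS expnD (expnSr q k.+1) q_d.
move: (q ^ \dim E)%N (q ^ k.+1)%N a_gt0 b_gt0 => a b a_gt0 b_gt0 s_eq s_count fD.
have D_gt0 : (0 < a * (b * q) - a)%N.
  by rewrite subn_gt0 ltn_Pmulr // (leq_trans q_gt1) // leq_pmull.
apply/eqP; rewrite -(eqn_pmul2r D_gt0) fD; apply/eqP.
(* Here [a = q ^ \dim E] and [b = q ^ k.+1]. Each member over [E] has [a * (b * q) - a] vectors
   outside [E], so the quotient [b + 1] is the new factor of the product. *)
suff -> : s' = ((b + 1) * (a * (b * q) - a))%N by rewrite mulnC mulnA.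
apply/eqP; rewrite -(eqn_pmul2r (ltnW q_gt1)); apply/eqP.
by nia.
Qed.

Lemma card_family k : d = k.+1 -> #|M| = (\prod_(i < k) (q ^ i.+1 + 1))%N.
Proof.
move=> d_eq.
rewrite -(card_family_over totally_singular0); last by rewrite dimv0 add0n d_eq.
by apply: eq_card => W; rewrite inE sub0v andbT.
Qed.

(** * Moments of the number of generators through a singular vector *)

Definition singular_vectors : {set 'rV[F]_n} := [set v | (v != 0) && (Q v == 0)].

Lemma sum_mem_singular_vectors U :
  ts U -> (\sum_(v in singular_vectors) (v \in U) = q ^ \dim U - 1)%N.
Proof.
move=> /totally_singularP tU; rewrite -card_vspace -sum1_card [in RHS](bigD1 0) ?mem0v //= addKn.
rewrite [RHS]big_mkcond [LHS]big_mkcond /=; apply: eq_bigr => v _; rewrite inE.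
have [Uv|_] := boolP (v \in U); last by case: ifP.
by rewrite tU // eqxx andbT.
Qed.

(** This is [card_singular_perp] for [E = 0], with the zero vector removed. Each singular point is
    counted [q - 1] times. *)
Lemma card_singular_vectors k :
  d = k.+1 -> #|singular_vectors| = ((q ^ d - 1) * (q ^ k + 1))%N.
Proof.
move=> d_eq; have := card_singular_perp totally_singular0.
have -> : singular_perp 0 = 0 |: singular_vectors.
  apply/setP => v; rewrite !inE; have [->|] := eqVneq v 0.
    by rewrite qform0 eqxx mem0v.
  move=> _ /=; suff -> : v \in perp 0 by [].
  by rewrite memvE sub_perpC sub0v.
have q_n : (q ^ n = q ^ d * q ^ d)%N by rewrite -expnD addnn Q_hyperbolic.
rewrite cardsU1 inE eqxx /= dimv0 subn0 q_n d_eq !expnS.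
have := card_expn_gt0 k; have := card_field_gt1.
move: (q ^ k)%N => b q_gt1 b_gt0 card_eq.
apply/eqP; rewrite -(eqn_pmul2r (ltnW q_gt1)); apply/eqP; move: card_eq.
have [c c_eq] : exists c, (q * b = c.+1)%N by exists (q * b).-1; nia.
have -> : ((q * b - 1) * (b + 1) * q = c * c.+1 + c * q)%N.
  by rewrite -c_eq c_eq subn1 /= -c_eq; ring.
by rewrite c_eq; move: #|singular_vectors| #|F| => s y; lia.
Qed.

(* The number of members of [S] through a singular vector has prescribed first
   and second moments, so Cauchy-Schwarz bounds [#|S|]. *)
Lemma partial_spread_bound k (S : {set subspace}) : d = k.+1 -> (0 < #|S|)%N ->
  {in S, forall W, generator W} ->
  {in S &, forall W Z, W != Z -> \dim (W :&: Z) = 1%N} ->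
  (#|S| * (q ^ d - 1) <= (q ^ k + 1) * (q ^ d - 1 + #|S|.-1 * (q - 1)))%N.
Proof.
move=> d_eq S_gt0 gS capS; pose x v := (\sum_(W in S) (v \in W))%N.
have sum_x : (\sum_(v in singular_vectors) x v = #|S| * (q ^ d - 1))%N.
  rewrite exchange_big -sum_nat_const; apply: eq_bigr => W SW.
  by rewrite sum_mem_singular_vectors ?generator_ts ?generator_dim ?gS.
have sum_x2 : (\sum_(v in singular_vectors) x v ^ 2 =
    #|S| * (q ^ d - 1 + #|S|.-1 * (q - 1)))%N.
  rewrite -sum_nat_const.
  (* The square [x v ^ 2] counts ordered pairs of members through [v]: a pair [W = Z] contributes
     [q ^ d - 1] in total, any other pair [q - 1]. *)
  under eq_bigr do rewrite -mulnn big_distrlr /=.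
  rewrite exchange_big; apply: eq_bigr => W SW; rewrite exchange_big /=.
  under eq_bigr => Z SZ.
    under eq_bigr do rewrite mulnb -memv_cap.
    rewrite sum_mem_singular_vectors; last first.
      exact: totally_singularS (capvSl _ _) (generator_ts (gS W SW)).
    over.
  rewrite (bigD1 W) //= capvv (generator_dim (gS W SW)); congr (_ + _)%N.
  rewrite (cardsD1 W) SW /= -sum_nat_const.
  apply: congr_big => // Z; first by rewrite !inE andbC.
  by case/andP => SZ neZW; rewrite capS // eq_sym.
have A_gt0 : (0 < q ^ d - 1)%N.
  by rewrite subn_gt0 d_eq -{1}(expn0 q) ltn_exp2l ?card_field_gt1.
have := sqr_sum_leq singular_vectors x.
rewrite sum_x sum_x2 (card_singular_vectors d_eq) -mulnn => CS.
rewrite -(leq_pmul2l (_ : 0 < #|S| * (q ^ d - 1))%N) ?muln_gt0 ?S_gt0 //.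
by apply: leq_trans CS _; rewrite mulnACA (mulnC #|S|).
Qed.

(** * Generators adjacent to a fixed generator *)

Lemma neighbour_unique Z W v : generator Z -> generator W -> adjacent Z W ->
  v \in W -> v \notin Z -> W = neighbour v Z.
Proof.
move=> gZ gW adj Wv Zv; have Qv := generatorP gW Wv.
apply/esym/generator_eq => //; first exact: neighbour_generator.
rewrite subv_add -memvE Wv andbT.
suff <- : (Z :&: W = Z :&: perp <[v]>)%VS by rewrite capvSr.
apply/eqP; rewrite eqEdim capvS ?sub_perp_generator -?memvE //=.
by have := dim_generator_cap_line gZ Zv; rewrite -adj; lia.
Qed.

(** Each [W] in [C] has [q ^ d - q ^ (d - 1)] vectors outside [Z], and by [neighbour_unique] these
    sets are disjoint. They lie among the [(q ^ d - 1) * q ^ (d - 1)] singular vectors outside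
    [Z]. *)
Lemma card_adjacent_generators Z (C : {set subspace}) : generator Z ->
  {in C, forall W, generator W /\ adjacent Z W} ->
  (#|C| * (q - 1) <= q ^ d - 1)%N.
Proof.
move=> gZ gC; have [->|[W0 CW0]] := set_0Vmem C; first by rewrite cards0.
have [k d_eq] : exists k, d = k.+1 by have [_ <-] := gC W0 CW0; eexists.
pose g v W := ((v \in W) && (v \notin Z) : nat).
have sum_g W : W \in C -> (\sum_(v in singular_vectors) g v W = q ^ d - q ^ k)%N.
  move=> CW; have [gW adj] := gC W CW.
  have := sum_mem_singular_vectors (generator_ts gW).
  have := sum_mem_singular_vectors (totally_singularS (capvSl Z W) (generator_ts gZ)).
  have -> : \dim (Z :&: W) = k by move: adj; rewrite /adjacent d_eq => -[].
  have -> : (\sum_(v in singular_vectors) (v \in W) = \sum_(v in singular_vectors) g v W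
      + \sum_(v in singular_vectors) (v \in (Z :&: W)%VS))%N.
    rewrite -big_split; apply: eq_bigr => v _; rewrite /g memv_cap.
    by case: (v \in W); case: (v \in Z).
  by rewrite (generator_dim gW); have := card_expn_gt0 k; lia.
have sum_notin : (\sum_(v in singular_vectors) (v \notin Z) + (q ^ d - 1)
    = #|singular_vectors|)%N.
  rewrite -(generator_dim gZ) -sum_mem_singular_vectors ?generator_ts // -big_split.
  by rewrite -sum1_card; apply: eq_bigr => v _; case: (v \in Z).
have : (\sum_(W in C) \sum_(v in singular_vectors) g v W
    <= \sum_(v in singular_vectors) (v \notin Z))%N.
  rewrite exchange_big; apply: leq_sum => v _; rewrite /g.
  have [_|Zv] := boolP (v \in Z); first by rewrite big1 // => W _; rewrite andbF.
  apply: leq_trans (_ : #|[set W in C | v \in W]| <= _)%N.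
    rewrite -sum1_card big_mkcond [leqRHS]big_mkcond /=; apply: leq_sum => W _.
    by rewrite inE andbT; case: (W \in C); case: (v \in W).
  apply: leq_trans (_ : #|[set neighbour v Z]| <= _)%N; last by rewrite cards1.
  apply: subset_leq_card; apply/subsetP => W.
  rewrite !inE => /andP[CW Wv]; have [gW adj] := gC W CW.
  by apply/eqP/neighbour_unique.
rewrite (eq_bigr _ sum_g) sum_nat_const; move: sum_notin.
rewrite (card_singular_vectors d_eq) d_eq expnS.
have := card_expn_gt0 k; move: (q ^ k)%N => b b_gt0.
rewrite mulnDr muln1 => /addIn -> le_t.
rewrite -(leq_pmul2r b_gt0); apply: leq_trans le_t.
by rewrite -mulnA mulnBl mul1n.
Qed.

Lemma adjacent_of_parity W Z : W \in M -> generator Z -> Z \notin M ->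
  (d <= \dim (W :&: Z) + 2)%N -> adjacent W Z.
Proof.
move=> MW gZ nMZ d_le; have gW := family_generator MW.
have := family_parity gW gZ; rewrite MW (negPf nMZ) /adjacent => /esym/negbFE odd_codim.
by move: d_le odd_codim (dim_capr_generator W gZ); dim_lia.
Qed.

Lemma adjacent_notin_family W Z :
  W \in M -> generator Z -> adjacent W Z -> Z \notin M.
Proof. by move=> MW gZ /(family_adjacent (family_generator MW) gZ) <-. Qed.

Definition codim2_clique (C : {set subspace}) :=
  {in C &, forall W Z, W != Z -> (\dim (W :&: Z) + 2)%N = d}.

(** * Cliques: generators of one family meeting pairwise in codimension 2 *)

Section CliqueStructure.

Variables (C : {set subspace}) (U1 U2 : subspace).
Hypotheses (C_family : C \subset M) (C_clique : codim2_clique C).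
Hypotheses (C_U1 : U1 \in C) (C_U2 : U2 \in C) (neU : U1 != U2).

Let L := (U1 :&: U2)%VS.

Let C_M W : W \in C -> W \in M. Proof. exact: (subsetP C_family). Qed.
Let C_gen W : W \in C -> generator W. Proof. by move/C_M/family_generator. Qed.
Let dim_L : (\dim L + 2)%N = d. Proof. exact: C_clique. Qed.
Let ts_L : ts L.
Proof. exact: totally_singularS (capvSl _ _) (generator_ts (C_gen C_U1)). Qed.

Let sub_perp_L : (U1 + U2 <= perp L)%VS.
Proof. by rewrite subv_add !sub_perp_generator ?capvSl ?capvSr ?C_gen. Qed.

(** [W :&: U1] and [W :&: U2] have dimension [d - 2] and meet in [W :&: L]. If they spanned [W],
    then [W] would lie in [perp L], forcing [L <= W]; so their sum has dimension at most [d - 1]. *)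
Lemma dim_cap_clique W : W \in C -> ~~ (L <= W)%VS -> (\dim (W :&: L) + 3)%N = d.
Proof.
move=> CW nLW; have gW := C_gen CW.
have neW1 : W != U1 by apply: contraNneq nLW => ->; rewrite capvSl.
have neW2 : W != U2 by apply: contraNneq nLW => ->; rewrite capvSr.
have cap_eq : ((W :&: U1) :&: (W :&: U2) = W :&: L)%VS.
  by rewrite capvA (capvC _ W) capvA capvv -capvA.
have := dimv_sum_cap (W :&: U1) (W :&: U2); rewrite cap_eq.
have := C_clique CW C_U1 neW1; have := C_clique CW C_U2 neW2.
have sub_sum : (W :&: U1 + W :&: U2 <= W)%VS by rewrite subv_add !capvSl.
have : (\dim (W :&: U1 + W :&: U2) < d)%N.
  rewrite ltn_neqAle -{2}(generator_dim gW) dimvS // andbT.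
  apply: contraNN nLW => /eqP dim_eq.
  have W_eq : (W :&: U1 + W :&: U2 = W)%VS.
    by apply/eqP; rewrite eqEdim sub_sum dim_eq (generator_dim gW) /=.
  rewrite -(perp_generator gW) sub_perpC (subv_trans _ sub_perp_L) //.
  by rewrite -[X in (X <= _)%VS]W_eq addvS ?capvSr.
have : (\dim (W :&: L) < \dim L)%N.
  rewrite ltnNge; apply: contraNN nLW => dim_le.
  have /eqP <- : (W :&: L == L)%VS by rewrite eqEdim capvSr.
  exact: capvSl.
by move: dim_L; dim_lia.
Qed.

(** The projection of [W] onto [L], a candidate for a common neighbour of all of [C]. *)
Let apex W := (L + (W :&: perp L))%VS.

Let dim_cap_perp_L W : W \in C -> ~~ (L <= W)%VS -> (\dim (W :&: perp L)).+1 = d.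
Proof.
move=> CW nLW; have := dim_generator_cap_perp L (C_gen CW).
by have := dim_cap_clique CW nLW; rewrite capvC; move: dim_L; dim_lia.
Qed.

Lemma apex_generator W : W \in C -> ~~ (L <= W)%VS -> generator (apex W).
Proof.
move=> CW nLW; have gW := C_gen CW; apply/andP; split.
  rewrite totally_singularD ?capvSr //.
  exact: totally_singularS (capvSl _ _) (generator_ts gW).
have := dimv_sum_cap L (W :&: perp L).
have -> : (L :&: (W :&: perp L) = W :&: L)%VS.
  by rewrite capvA (capvC L W) -capvA (capv_idPl (totally_singular_perp ts_L)).
rewrite -/(apex W).
by have := dim_cap_clique CW nLW; have := dim_cap_perp_L CW nLW; move: dim_L; dim_lia.
Qed.

Lemma apex_adjacent W : W \in C -> ~~ (L <= W)%VS -> adjacent W (apex W).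
Proof.
move=> CW nLW; have gW := C_gen CW; have gZ := apex_generator CW nLW.
have neWZ : W != apex W by apply: contraNneq nLW => ->; rewrite addvSl.
have := generator_cap_neq gW gZ neWZ; have := dim_cap_perp_L CW nLW.
have /dimvS : (W :&: perp L <= W :&: apex W)%VS by rewrite subv_cap capvSl addvSr.
by rewrite /adjacent; dim_lia.
Qed.

Lemma apex_notin_family W : W \in C -> ~~ (L <= W)%VS -> apex W \notin M.
Proof.
move=> CW nLW; apply: (adjacent_notin_family (C_M CW)).
  exact: apex_generator.
exact: apex_adjacent.
Qed.

(** Distinct apexes lie in the same family and contain [L], so by parity they meet exactly in [L].
    Then [T], contained in both, lies in [L]; its dimension is at least [d - 3], so it equals both
    [W :&: L] and [W' :&: L]. *)
Lemma apex_or_cap W W' : W \in C -> ~~ (L <= W)%VS -> W' \in C -> ~~ (L <= W')%VS ->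
  apex W = apex W' \/ (W :&: L = W' :&: L)%VS.
Proof.
move=> CW nLW CW' nLW'; have [|neZ] := eqVneq (apex W) (apex W'); [by left | right].
have [gZ gZ'] := (apex_generator CW nLW, apex_generator CW' nLW').
have neW : W != W' by apply: contraNneq neZ => ->.
have Z_cap : (apex W :&: apex W' = L)%VS.
  apply/esym/eqP; rewrite eqEdim subv_cap !addvSl /=.
  have := generator_cap_neq gZ gZ' neZ; have := family_parity gZ gZ'.
  rewrite !(negPf (apex_notin_family _ _)) //= => /esym.
  by have := dim_capr_generator (apex W) gZ'; move: dim_L; dim_lia.
pose T := (W :&: W' :&: perp L)%VS.
have sTL : (T <= L)%VS.
  rewrite -Z_cap subv_cap; apply/andP; split; apply: subv_trans (addvSr _ _).
    by rewrite subv_cap capvSr (subv_trans (capvSl _ _)) ?capvSl.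
  by rewrite subv_cap capvSr (subv_trans (capvSl _ _)) ?capvSr.
have dT : (d <= \dim T + 3)%N.
  have := dimv_sum_cap (W :&: W') (W :&: perp L).
  have := C_clique CW CW' neW; have := dim_cap_perp_L CW nLW.
  have -> : (W :&: W' :&: (W :&: perp L) = T)%VS.
    by rewrite capvA (capv_idPl (capvSl W W')).
  have /dimvS : (W :&: W' + W :&: perp L <= W)%VS by rewrite subv_add !capvSl.
  by rewrite (generator_dim (C_gen CW)); dim_lia.
have T_eq X : X \in C -> ~~ (L <= X)%VS -> (T <= X)%VS -> T = (X :&: L)%VS.
  move=> CX nLX sTX; apply/eqP; rewrite eqEdim subv_cap sTX sTL /=.
  by move: dT; have := dim_cap_clique CX nLX; dim_lia.
have sTW : (T <= W)%VS by apply: subv_trans (capvSl _ _) (capvSl _ _).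
have sTW' : (T <= W')%VS by apply: subv_trans (capvSl _ _) (capvSr _ _).
exact: etrans (esym (T_eq W CW nLW sTW)) (T_eq W' CW' nLW' sTW').
Qed.

End CliqueStructure.

(* A member [W] not containing [L = U1 :&: U2] meets [L] in a hyperplane of [L],
   and [L + (W :&: perp L)] is a generator adjacent to [W]. By [apex_or_cap], two
   such members share the hyperplane or this generator; hence all of them share
   one or all of them share the other. *)
Lemma codim2_clique_structure (C : {set subspace}) :
  C \subset M -> codim2_clique C -> (1 < #|C|)%N ->
  (exists2 Z, generator Z & {in C, forall W, adjacent Z W}) \/
  (exists2 K, ts K /\ (\dim K + 3)%N = d & {in C, forall W, K <= W}%VS).
Proof.
move=> CM clC /card_gt1P[U1 [U2 [CU1 CU2 neU]]].
have dim_L := clC _ _ CU1 CU2 neU; set L := (U1 :&: U2)%VS in dim_L.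
have C_M W : W \in C -> W \in M by apply: (subsetP CM).
have C_gen W : W \in C -> generator W by move/C_M/family_generator.
have adj_L Z : generator Z -> Z \notin M -> (L <= Z)%VS ->
    forall W, W \in C -> (L <= W)%VS -> adjacent Z W.
  move=> gZ nMZ sLZ W CW sLW; rewrite /adjacent capvC.
  apply: adjacent_of_parity => //; first exact: C_M.
  by rewrite -dim_L leq_add2r dimvS // subv_cap sLW.
have [/forall_inP all_L | ] := boolP [forall W in C, (L <= W)%VS].
  have /subvPn[x U2x U1x] : ~~ (U2 <= U1)%VS.
    by apply: contra neU => /(generator_eq (C_gen _ CU2) (C_gen _ CU1)) ->.
  have Qx := generatorP (C_gen _ CU2) U2x.
  have gZ := neighbour_generator (C_gen _ CU1) Qx U1x.
  (* This generator of the other family contains [L], since [x] in [U2] is orthogonal to [L]; parity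
     then makes it adjacent to every member over [L]. *)
  left; exists (neighbour x U1) => // W CW; apply: adj_L => //; last exact: all_L.
    apply: (adjacent_notin_family (C_M _ CU1)) => //.
    exact: neighbour_adjacent (C_gen _ CU1) Qx U1x.
  rewrite (subv_trans _ (addvSl _ _)) // subv_cap capvSl sub_perpC -memvE.
  by rewrite (subvP (sub_perp_generator (C_gen _ CU2) (capvSr _ _))).
rewrite negb_forall_in => /exists_inP[W0 CW0 nLW0].
have [/forall_inP all_K | ] := boolP [forall W in C, (W0 :&: L <= W)%VS].
  right; exists (W0 :&: L)%VS => //; split; last exact: (dim_cap_clique CM clC).
  exact: totally_singularS (capvSl _ _) (generator_ts (C_gen _ CW0)).
rewrite negb_forall_in => /exists_inP[W1 CW1 nKW1].
have nLW1 : ~~ (L <= W1)%VS by apply: contra nKW1; apply: subv_trans (capvSr _ _).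
have neK : (W0 :&: L)%VS <> (W1 :&: L)%VS by move=> K_eq; rewrite K_eq capvSl in nKW1.
have apexP := apex_or_cap CM clC CU1 CU2 neU; rewrite -/L in apexP.
pose Z := (L + (W0 :&: perp L))%VS.
have gZ : generator Z by apply: (apex_generator CM clC).
left; exists Z => // W CW; have [sLW | nLW] := boolP (L <= W)%VS.
  apply: adj_L => //; last exact: addvSl.
  exact: (apex_notin_family CM clC).
have eqZ W' : W' \in C -> ~~ (L <= W')%VS -> (W' :&: L)%VS <> (W0 :&: L)%VS ->
    (L + (W' :&: perp L))%VS = Z.
  by move=> CW' nLW' neK'; case: (apexP W' W0 CW' nLW' CW0 nLW0).
suff <- : (L + (W :&: perp L))%VS = Z.
  by rewrite /adjacent capvC; apply: (apex_adjacent CM clC).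
(* [W] cannot share its hyperplane of [L] with both [W0] and [W1]. If it shares that of [W0], its
   apex is that of [W1], which is [Z] because the hyperplanes of [W0] and [W1] differ. *)
case: (apexP W W0) => // K_eq; case: (apexP W W1) => // [-> | K_eq1].
  by apply: eqZ => // /esym.
by case: neK; rewrite -K_eq.
Qed.

(** Over a common [K] there are at most [(q + 1) * (q ^ 2 + 1)] members; times [q - 1] this is
    [q ^ 4 - 1], whence the condition [3 < d]. *)
Lemma codim2_clique_bound (C : {set subspace}) :
  (3 < d)%N -> C \subset M -> codim2_clique C -> (#|C| * (q - 1) <= q ^ d - 1)%N.
Proof.
move=> d_gt3 CM clC; have q_gt1 := card_field_gt1.
have [C_gt1|C_le1] := ltnP 1 #|C|; last first.
  apply: leq_trans (leq_mul C_le1 (leqnn _)) _.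
  by rewrite mul1n leq_sub2r // -{1}(expn1 q) leq_exp2l // (ltn_trans _ d_gt3).
have [[Z gZ adjZ] | [K [tK dK] sKC]] := codim2_clique_structure CM clC C_gt1.
  apply: (card_adjacent_generators gZ) => W CW; split; last exact: adjZ.
  exact/family_generator/(subsetP CM).
have C_le : (#|C| <= #|family_over K|)%N.
  apply: subset_leq_card; apply/subsetP => W CW.
  by rewrite inE (subsetP CM) //= sKC.
rewrite (card_family_over tK dK) !big_ord_recr big_ord0 /= in C_le.
apply: leq_trans (leq_mul C_le (leqnn _)) _.
apply: leq_trans (_ : q ^ 4 - 1 <= _)%N; last by rewrite leq_sub2r // leq_exp2l.
have [k ->] : exists k, q = k.+1 by case: q q_gt1 => // k; exists k.
by rewrite subn1 /= expn1 !expnS expn0; nia.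
Qed.

(** For [d = 5], members of one family meet in odd dimension, so excluding 5 and 3 leaves 1 and
    [partial_spread_bound] applies. *)
Lemma coclique_bound (S : {set subspace}) : d = 5 -> S \subset M ->
  {in S &, forall W Z, W != Z -> \dim (W :&: Z) != 3%N} ->
  (#|S| * (q ^ 2 + q + 1) <= (q ^ 4 + 1) * (q + 1) * (q ^ 2 + 1))%N.
Proof.
move=> d_eq SM coS; have [->|S_gt0] := posnP #|S|; first by [].
have gS : {in S, forall W, generator W}.
  by move=> W SW; apply/family_generator/(subsetP SM).
have := partial_spread_bound d_eq S_gt0 gS.
have capS : {in S &, forall W Z, W != Z -> \dim (W :&: Z) = 1%N}.
  move=> W Z SW SZ neWZ; have := coS W Z SW SZ neWZ.
  have := family_cap (subsetP SM _ SW) (subsetP SM _ SZ).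
  have := generator_cap_neq (gS W SW) (gS Z SZ) neWZ; rewrite d_eq.
  by case: (\dim _) => [|[|[|[|[|k]]]]].
move=> /(_ capS); rewrite d_eq.
have q_gt1 := card_field_gt1; rewrite !subn1 predn_exp !big_ord_recr big_ord0 /= add0n.
rewrite (mulnC #|S|.-1) -mulnDr !(mulnCA _ q.-1) leq_pmul2l; last by rewrite -subn1 subn_gt0.
case: #|S| S_gt0 => // m _ /=; rewrite !expnS expn0 !muln1 => le_m.
(* With [q - 1] already cancelled, both sides share the term [#|S| * (q ^ 4 + 1)]; what remains is
   [q] times the claim. *)
rewrite -(leq_pmul2l (ltnW q_gt1)); move: le_m; clear; move: #|F| => t.
by lia.
Qed.

End QuadraticSpaces.

Theorem theorem3p1 (q : nat)
  (hq : exists p k : nat, [/\ prime p, (0 < k)%N & q = (p ^ k)%N])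
  (F : finFieldType) (hF : #|F| = q)
  (Q : 'rV[F]_10 -> F)
  (hQ : quadratic_form Q) (hnd : nondegenerate_qform Q) (hplus : hyperbolic Q)
  (M : {set {vspace 'rV[F]_10}}) (hM : M \in families Q) :
  separating (half_dual_polar_graph M).
Proof.
have d_eq : witt_index Q = 5 by apply: double_inj.
have q_gt1 : (1 < q)%N by rewrite -hF finNzRing_gt1.
have valM (A : {set {U : {vspace 'rV[F]_10} | U \in M}}) : val @: A \subset M.
  by apply/subsetP => _ /imsetP[U _ ->]; apply: valP.
have card_val (A : {set {U : {vspace 'rV[F]_10} | U \in M}}) : #|val @: A| = #|A|.
  by apply: card_imset; apply: val_inj.
set w := clique_number (half_dual_polar_graph M).
set a := coclique_number (half_dual_polar_graph M).
have clique_le : (w * (q - 1) <= q ^ 5 - 1)%N.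
  apply: (big_ind (fun m => m * (q - 1) <= q ^ 5 - 1)%N) => // [m1 m2 h1 h2 | A clA].
    by rewrite maxnMl geq_max h1.
  rewrite -card_val; have := codim2_clique_bound hQ hnd hplus hM (C := val @: A).
  rewrite d_eq hF; apply=> // _ _ /imsetP[U AU ->] /imsetP[W AW ->] neUW; rewrite d_eq.
  have /forall_inP/(_ U AU)/forall_inP/(_ W AW)/implyP := clA.
  move=> /(_ _)/eqP -> //; by apply: contraNneq neUW => ->.
have coclique_le : (a * (q ^ 2 + q + 1) <= (q ^ 4 + 1) * (q + 1) * (q ^ 2 + 1))%N.
  apply: (big_ind (fun m => m * (q ^ 2 + q + 1) <= (q ^ 4 + 1) * (q + 1) * (q ^ 2 + 1))%N).
  - by [].
  - by move=> m1 m2 h1 h2; rewrite maxnMl geq_max h1.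
  move=> A coA; rewrite -card_val -hF.
  apply: (coclique_bound hQ hnd hplus hM d_eq) => //.
  move=> _ _ /imsetP[U AU ->] /imsetP[W AW ->] neUW.
  have /forall_inP/(_ U AU)/forall_inP/(_ W AW)/implyP := coA.
  by apply; apply: contraNneq neUW => ->.
rewrite /separating -/w -/a card_sig.
have -> : #|[pred U | U \in M]| = #|M| by apply: eq_card => U; rewrite inE.
rewrite (card_family hQ hnd hplus hM d_eq) !big_ord_recr big_ord0 /= hF mul1n expn1.
(* The factors [q - 1] and [q ^ 2 + q + 1] are those of the two bounds; their product [q ^ 3 - 1]
   and the factor [q ^ 3 + 1] of [#|M|] make [q ^ 6 - 1], to be compared with [q ^ 5 - 1]. *)
have sq_gt0 : (0 < (q - 1) * (q ^ 2 + q + 1))%N by rewrite muln_gt0 subn_gt0 q_gt1 addn1.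
rewrite -(ltn_pmul2r sq_gt0) mulnACA; apply: leq_ltn_trans (leq_mul clique_le coclique_le) _.
have -> : ((q - 1) * (q ^ 2 + q + 1) = q ^ 3 - 1)%N.
  by rewrite !subn1 predn_exp !big_ord_recr big_ord0 /= add0n expn0 expn1 addnC addnAC addnA.
have cube : ((q ^ 3 + 1) * (q ^ 3 - 1) = q ^ 6 - 1)%N.
  by rewrite mulnC -subn_sqr -expnM exp1n.
have -> : ((q + 1) * (q ^ 2 + 1) * (q ^ 3 + 1) * (q ^ 4 + 1) * (q ^ 3 - 1) =
    (q ^ 6 - 1) * ((q ^ 4 + 1) * (q + 1) * (q ^ 2 + 1)))%N.
  by rewrite -cube; move: (q ^ 3 - 1)%N => r; ring.
rewrite ltn_pmul2r ?muln_gt0 ?addn1 //.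
by rewrite ltn_sub2rE ?expn_gt0 ?ltn_exp2l ?(ltnW q_gt1).
Qed.
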